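(* For a division ring $\mathbb{D}$, the following conditions are equivalent. (i) Every injective scalar Jordan semi-triple map $f:\mathbb{D}\to\mathbb{D}$ is additive. (ii) Every injective scalar Jordan semi-triple map $f:\mathbb{D}\to\mathbb{D}$ has the form $f(x)=\varepsilon\theta(x)$, where $\varepsilon\in\{1,-1\}$ and $\theta$ is an injective endomorphism or an injective anti-endomorphism of $\mathbb{D}$. (iii) $\mathbb{D}$ is isomorphic to one of $\mathbb{F}_2,\mathbb{F}_3,\mathbb{F}_4$.
   Context: A scalar Jordan semi-triple map on a division ring $\mathbb{D}$ is a map $f:\mathbb{D}\to\mathbb{D}$ (no additivity assumed) such that $f(xyx)=f(x)f(y)f(x)$ for all $x,y\in\mathbb{D}$. Endomorphisms and anti-endomorphisms of $\mathbb{D}$ are ring (anti-)endomorphisms, in particular additive. $\mathbb{F}_q$ denotes the field with $q$ elements. *)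

(* Defs.v *)
From HB Require Import structures.
From mathcomp Require Import all_boot all_order all_algebra.

Set Implicit Arguments.
Unset Strict Implicit.
Unset Printing Implicit Defensive.

Import GRing.Theory.
Local Open Scope ring_scope.

(* Multiplication in a [unitRingType] is not assumed commutative, so this says
   that [D] is a division ring. *)
Definition division_ring (D : unitRingType) : Prop :=
  forall x : D, x != 0 -> x \is a GRing.unit.

Definition jordan_semi_triple (D : unitRingType) (f : D -> D) : Prop :=
  forall x y : D, f (x * y * x) = f x * f y * f x.

Definition additive_map (D : unitRingType) (f : D -> D) : Prop :=
  {morph f : x y / x + y}.

Definition ring_endomorphism (D : unitRingType) (theta : D -> D) : Prop :=
  exists phi : {rmorphism D -> D}, theta =1 phi.

(* [D^c] is [D] with the reversed multiplication. *)
Definition ring_anti_endomorphism (D : unitRingType) (theta : D -> D) : Prop :=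
  exists phi : {rmorphism D -> D^c}, theta =1 phi.

(* Up to isomorphism there is at most one field with [q] elements. *)
Definition isomorphic_to_Fq (D : unitRingType) (q : nat) : Prop :=
  exists (K : finFieldType) (phi : {rmorphism D -> K}),
    #|K| = q /\ bijective phi.

(* Main.v *)
(* Inversion, extended by 0^-1 = 0, is an injective Jordan semi-triple map of
   every division ring.  If it is additive, then comparing (x + 1)^-1 with
   x^-1 + 1 shows that x^2 + x + 1 = 0 for every x other than 0 and -1.  When
   2 <> 0 the value x = 1 gives 3 = 0, hence (x - 1)^2 = 0 and D = {0, 1, -1}.
   When 2 = 0 and a is not in {0, 1}, an element y outside {0, 1, a, a + 1}
   would satisfy a y + y a = 1; so would a y in place of y, and
   a (a y) + (a y) a = a (a y + y a) then forces a = 1.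
   Conversely, on a field with at most 4 elements an injective Jordan
   semi-triple map fixes 0 and sends 1 to 1 or -1, which leaves only the
   identity, its opposite, and the Frobenius map of F_4. *)
Require Import Defs.
From HB Require Import structures.
From Stdlib Require Import Classical_Prop.
From mathcomp Require Import all_boot all_order all_algebra all_field.
From mathcomp Require Import ring.

Set Implicit Arguments.
Unset Strict Implicit.
Unset Printing Implicit Defensive.

Import GRing.Theory.
Local Open Scope ring_scope.

Lemma rmorphism_of_morph (R S : pzRingType) (h : R -> S) :
  {morph h : x y / x + y} -> {morph h : x y / x * y} -> h 1 = 1 ->
  exists phi : {rmorphism R -> S}, h =1 phi.
Proof.
move=> hD hM h1.
have h0 : h 0 = 0 by apply: (addrI (h 0)); rewrite -hD !addr0.
pose hA := GRing.isNmodMorphism.Build R S h (conj h0 hD).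
pose hR := GRing.isMonoidMorphism.Build R S h (conj h1 hM).
pose phi : {rmorphism R -> S} := HB.pack h hA hR.
by exists phi.
Qed.

Lemma rmorphism_inverse (R S : pzRingType) (phi : {rmorphism R -> S}) g :
  cancel phi g -> cancel g phi -> exists psi : {rmorphism S -> R}, g =1 psi.
Proof.
move=> phiK gK; apply: rmorphism_of_morph => [x y|x y|];
  apply: (can_inj phiK).
- by rewrite rmorphD !gK.
- by rewrite rmorphM !gK.
- by rewrite rmorph1 gK.
Qed.

Section DivisionRing.

Variables (D : unitRingType) (hD : division_ring D).

Lemma division_ring_mulf_eq0 (x y : D) : x * y = 0 -> x = 0 \/ y = 0.
Proof.
have [->|/hD xU] := eqVneq x 0 => xy0; first by left.
by right; apply: (mulrI xU); rewrite mulr0.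
Qed.

(* Commutativity of [D] comes from Wedderburn's little theorem. *)
Lemma division_ring_enum_isomorphic (s : seq D) :
  uniq s -> (forall x, x \in s) -> isomorphic_to_Fq D (size s).
Proof.
move=> s_uniq s_all.
have idxK : pcancel (index^~ s) (fun n => Some (nth 0 s n)).
  by move=> x; rewrite nth_index.
have fA : Finite.axiom s by apply: Finite.uniq_enumP => // x; rewrite s_all.
pose cM := Choice_isCountable.Build D idxK.
pose fM := isFinite.Build D fA.
pose R : finUnitRingType := HB.pack (D : Type) cM fM (GRing.UnitRing.on D).
have domR : GRing.integral_domain_axiom R.
  by move=> x y /division_ring_mulf_eq0[] ->; rewrite eqxx ?orbT.
pose K := FinDomainFieldType domR.
(* [K] is built on the carrier of [D] itself, so the identity is the isomorphism. *)
have [phi phiE] : exists phi : {rmorphism D -> K}, (id : D -> K) =1 phi.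
  by apply: rmorphism_of_morph.
exists K, phi; split; last by exists id => x; rewrite -phiE.
by rewrite cardT enumT unlock.
Qed.

Lemma inv_jordan_semi_triple : jordan_semi_triple (@GRing.inv D).
Proof.
move=> x y.
have [->|x0] := eqVneq x 0; first by rewrite !(mul0r, mulr0, invr0).
have [->|y0] := eqVneq y 0; first by rewrite !(mul0r, mulr0, invr0).
have [xU yU] := (hD x0, hD y0).
by rewrite !invrM ?unitrMl // mulrA.
Qed.

Lemma small_of_additive_inv : additive_map (@GRing.inv D) ->
  [\/ isomorphic_to_Fq D 2, isomorphic_to_Fq D 3 | isomorphic_to_Fq D 4].
Proof.
move=> invD.
have invD_quad (x : D) : x != 0 -> x != -1 -> x * x + x + 1 = 0.
  rewrite -[x == -1]subr_eq0 opprK => x0 x10.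
  have [xU x1U] := (hD x0, hD x10).
  rewrite addrAC.
  (* Multiplying (x + 1)^-1 = x^-1 + 1 by x + 1 on the left and by x on the right clears both
     inverses and leaves x = (x + 1)(1 + x). *)
  have := congr1 (fun z => (x + 1) * z * x) (invD x 1).
  rewrite divrr // mul1r invr1 mulrDr mulrDl mulr1 -mulrA mulVr // mulr1.
  rewrite mulrDl mul1r => /esym E; apply: (addrI x).
  by rewrite addr0 -[RHS]E -!addrA; congr (_ + _); rewrite addrCA.
have [two0|two0] := eqVneq (1 + 1 : D) 0; last first.
  have one_neqN1 : (1 : D) != -1 by rewrite -subr_eq0 opprK.
  have three0 : 1 + 1 + 1 = 0 :> D.
    by rewrite -[RHS](invD_quad 1) ?oner_eq0 // mulr1.
  constructor 2; apply: (@division_ring_enum_isomorphic [:: 0; 1; -1]).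
    by rewrite /= !inE one_neqN1 !(eq_sym 0) oppr_eq0 oner_eq0.
  move=> x; rewrite !inE.
  case: eqVneq => //= x0; case: (eqVneq x (-1)) => [|x1];
    rewrite ?orbT ?orbF //.
  have : (x - 1) * (x - 1) = 0.
    have Nx : - x - x = x.
      apply/eqP; rewrite -opprD eqr_oppLR -addr_eq0.
      by rewrite -[x]mulr1 -!mulrDr three0 mulr0.
    rewrite -[RHS](invD_quad x x0 x1) mulrBr mulrBl mulr1 mul1r opprB.
    transitivity (x * x + (- x - x) + 1); last by rewrite Nx.
    by rewrite [1 - x]addrC !addrA.
  by case/division_ring_mulf_eq0 => /eqP; rewrite subr_eq0.
have N1 : -1 = 1 :> D by apply/esym/eqP; rewrite -addr_eq0 two0.
have addxx (x : D) : x + x = 0 by rewrite -[x]mulr1 -mulrDr two0 mulr0.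
have oppx (x : D) : - x = x by rewrite -[in LHS](mulr1 x) -mulrN N1 mulr1.
have quad (x : D) : x != 0 -> x != 1 -> x * x = x + 1.
  move=> x0 x1; apply/eqP; rewrite -subr_eq0 oppx addrA.
  by rewrite invD_quad // N1.
(* Nothing makes [D] finite yet, so the existence of a third element is decided classically. *)
have [[a [a0 a1]]|noa] := classic (exists a : D, a != 0 /\ a != 1); last first.
  constructor 1; apply: (@division_ring_enum_isomorphic [:: 0; 1]).
    by rewrite /= !inE eq_sym oner_eq0.
  move=> x; rewrite !inE; case: eqVneq => //= x0; case: eqVneq => //= x1.
  by case: noa; exists x.
constructor 3.
have a10 : a + 1 != 0 by rewrite addr_eq0 N1.
apply: (@division_ring_enum_isomorphic [:: 0; 1; a; a + 1]).
  rewrite /= !inE ![0 == _]eq_sym oner_eq0 (negPf a0) (negPf a10) /= andbT.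
  rewrite eq_sym (negPf a1) [1 == _]eq_sym -subr_eq0 addrK (negPf a0) /=.
  by rewrite eq_sym -subr_eq0 addrAC subrr add0r oner_eq0.
have anticomm (y : D) : y != 0 -> y != 1 -> y != a -> y != a + 1 ->
    a * y + y * a = 1.
  move=> y0 y1 ya ya1.
  have ay0 : a + y != 0 by rewrite addrC addr_eq0 oppx.
  have ay1 : a + y != 1.
    by apply: contra ya1 => /eqP <-; rewrite addrA addxx add0r.
  (* Since a + y also avoids 0 and 1, its square is a + y + 1; expanding it and replacing a^2 and
     y^2 by a + 1 and y + 1 isolates a y + y a. *)
  have := quad _ ay0 ay1.
  rewrite mulrDl !mulrDr (quad a) // (quad y) // => E.
  apply: (addrI (a + 1 + (y + 1))); rewrite -[RHS]addrA -[y + 1 + 1]addrA two0.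
  by rewrite addr0 [RHS]addrAC -E addrACA [y + 1 + _]addrC.
move=> y; rewrite !inE; apply/negP => /negP.
rewrite !negb_or => /and4P[y0 y1 ya ya1].
have aU := hD a0.
have ayE := anticomm y y0 y1 ya ya1.
have : a * (a * y) + a * y * a = 1.
  (* As 1 = a (a + 1) and a + 1 = a^2, cancelling a shows that a y equal to 1, a or a + 1 would make
     y equal to a + 1, 1 or a. *)
  apply: anticomm.
  - by apply/eqP=> /division_ring_mulf_eq0[]/eqP; apply/negP.
  - apply: contra ya1 => /eqP ay1; apply/eqP/(mulrI aU).
    by rewrite ay1 mulrDr mulr1 quad // addrAC addxx add0r.
  - by apply: contra y1 => /eqP; rewrite -[RHS]mulr1 => /(mulrI aU)->.
  - by apply: contra ya => /eqP; rewrite -quad // => /(mulrI aU)->.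
by rewrite -mulrA -mulrDr ayE mulr1 => /eqP; apply/negP.
Qed.

End DivisionRing.

(** Factoring x^q - x for q = 2, 3, 4 controls the elements without enumerating the field. For q = 4
    those outside {0, 1} are the two roots of x^2 + x + 1, which [g] either fixes or exchanges. *)
Lemma jordan_semi_triple_small_field (K : finFieldType) (g : K -> K) :
  (1 < #|K| <= 4)%N -> injective g -> jordan_semi_triple g ->
  exists (eps : K) (theta : {rmorphism K -> K}),
    (eps = 1 \/ eps = -1) /\ forall x, g x = eps * theta x.
Proof.
move=> cardK g_inj gJ.
have g0 : g 0 = 0.
  (* The triple (0, y, 0) gives g 0 = g 0 * g y * g 0, so a nonzero g 0 would make [g] constant. *)
  apply/eqP/negPn/negP => g00.
  have g_cst y : g y = (g 0)^-1.
    apply: (mulfI g00); apply: (mulIf g00).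
    by rewrite -gJ !mul0r divff // mul1r.
  by have /eqP := g_inj 0 1 (etrans (g_cst 0) (esym (g_cst 1)));
    rewrite eq_sym oner_eq0.
have g_eq0 x : (g x == 0) = (x == 0) by rewrite -{1}g0 (inj_eq g_inj).
have g1 : g 1 = 1 \/ g 1 = -1.
  have /eqP := gJ 1 1; rewrite !mulr1 -subr_eq0.
  rewrite (_ : _ - _ = g 1 * (1 - g 1) * (g 1 + 1)); last by ring.
  rewrite !mulf_eq0 g_eq0 oner_eq0 subr_eq0 addr_eq0 eq_sym.
  by case/orP=> /eqP->; [left | right].
have main : (forall x, g x = g 1 * x) \/
  2%:R = 0 :> K /\ forall x, g x = g 1 * x ^+ 2.
  have := @expf_card K.
  case: #|K| cardK => [|[|[|[|[|?]]]]] // _ xq.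
  - left=> x; have /eqP := xq x; rewrite -subr_eq0.
    rewrite (_ : _ - _ = x * (x - 1)); last by ring.
    by rewrite mulf_eq0 subr_eq0 => /orP[]/eqP->; rewrite ?g0 ?mulr0 ?mulr1.
  - have cases (x : K) : [\/ x = 0, x = 1 | x = -1].
      have /eqP := xq x; rewrite -subr_eq0.
      rewrite (_ : _ - _ = x * (x - 1) * (x + 1)); last by ring.
      rewrite !mulf_eq0 subr_eq0 addr_eq0 -orbA => /or3P[]/eqP->;
      by [constructor 1 | constructor 2 | constructor 3].
    left=> x; have [->|->|->] := cases x; rewrite ?g0 ?mulr0 ?mulr1 // mulrN1.
    case: (cases (g (-1))) => [/eqP|gN1|gN1].
    + by rewrite g_eq0 oppr_eq0 oner_eq0.
    (* When g 1 and g (-1) agree, the goal reduces to 1 and -1 being equal, which is what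
       injectivity yields. *)
    + case: g1 => g1; rewrite gN1 g1 ?opprK //.
      by apply: g_inj; rewrite g1 gN1.
    + case: g1 => g1; rewrite gN1 g1 ?opprK //.
      by apply: g_inj; rewrite g1 gN1.
  - have two0 : 2%:R = 0 :> K.
      have := xq (-1); rewrite (_ : (-1) ^+ 4 = 1); last by ring.
      by move=> N1; rewrite mulr2n {1}N1 addNr.
    have oppx (x : K) : - x = x.
      by apply/eqP; rewrite eq_sym -addr_eq0 -mulr2n -mulr_natl two0 mul0r.
    have {}g1 : g 1 = 1 by case: g1 => ->.
    have sqrE (x : K) : x != 0 -> x != 1 -> x ^+ 2 = x + 1.
      move=> x0 x1; have /eqP := xq x; rewrite -subr_eq0.
      rewrite (_ : _ - _ = x * (x - 1) * (x ^+ 2 + (x + 1))); last by ring.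
      by rewrite !mulf_eq0 subr_eq0 (negPf x0) (negPf x1) addr_eq0 oppx => /eqP.
    have two_roots (x y : K) : x != 0 -> x != 1 -> y != 0 -> y != 1 ->
        y = x \/ y = x + 1.
      move=> x0 x1 y0 y1.
      have /eqP : (y - x) * (y + (x + 1)) = 0.
        (* This identity holds in every commutative ring; the last term accounts for characteristic
           2, which [ring] does not see. *)
        transitivity ((y ^+ 2 - (y + 1)) - (x ^+ 2 - (x + 1)) + 2%:R * (y - x)).
          by ring.
        by rewrite !sqrE // two0; ring.
      rewrite mulf_eq0 subr_eq0 addr_eq0 oppx.
      by case/orP=> /eqP; [left | right].
    have g_eq1 x : (g x == 1) = (x == 1) by rewrite -{1}g1 (inj_eq g_inj).
    have [/existsP[a ga]|/existsPn g_id] := boolP [exists a, g a != a];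
      last first.
      by left=> x; rewrite g1 mul1r; apply/eqP/negPn.
    have a0 : a != 0 by apply: contra ga => /eqP->; rewrite g0.
    have a1 : a != 1 by apply: contra ga => /eqP->; rewrite g1.
    have {ga} gaE : g a = a + 1.
      case: (two_roots a (g a)); rewrite ?g_eq0 ?g_eq1 // => /eqP.
      by rewrite (negPf ga).
    (* Outside {0, 1} squaring is x |-> x + 1, so it remains to see that [g] moves every such x, as
       it moves a. *)
    right; split=> // x; rewrite g1 mul1r.
    have [->|x0] := eqVneq x 0; first by rewrite g0 expr0n.
    have [->|x1] := eqVneq x 1; first by rewrite g1 expr1n.
    rewrite sqrE //.
    case: (two_roots x (g x)); rewrite ?g_eq0 ?g_eq1 // => gx.
    case: (two_roots a x) => // [xa|]; first by rewrite xa.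
    (* Here g x = x = a + 1 = g a, and injectivity leads back to x = a. *)
    by rewrite -gaE -{1}gx => /g_inj xa; rewrite xa.
case: main => [gE|[two0 gE]].
  by exists (g 1), (idfun : {rmorphism K -> K}).
have pchar2 : 2 \in [pchar K] by rewrite inE /= two0 eqxx.
exists (g 1), (pFrobenius_aut pchar2 : {rmorphism K -> K}).
by split=> // x; rewrite gE pFrobenius_autE.
Qed.

(** Conjugation by an isomorphism with a field K turns [f] into a map of K, and the form found there
    is carried back to [D]. Both additivity and condition (ii) are read off from the result. *)
Lemma jordan_semi_triple_small_form (D : unitRingType) (f : D -> D) :
  [\/ isomorphic_to_Fq D 2, isomorphic_to_Fq D 3 | isomorphic_to_Fq D 4] ->
  injective f -> jordan_semi_triple f ->
  exists (eps : D) (theta : {rmorphism D -> D}),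
    [/\ eps = 1 \/ eps = -1, injective theta & forall x, f x = eps * theta x].
Proof.
move=> D_small f_inj fJ.
have [K [phi [cardK [psi0 phiK0 psiK0]]]] : exists (K : finFieldType)
    (phi : {rmorphism D -> K}), (1 < #|K| <= 4)%N /\ bijective phi.
  by case: D_small => -[K [phi [cardK phi_bij]]]; exists K, phi; rewrite cardK.
have [psi psiE] := rmorphism_inverse phiK0 psiK0.
have phiK : cancel phi psi by move=> x; rewrite -psiE.
have psiK : cancel psi phi by move=> x; rewrite -psiE.
have [||eps [theta [eps1 gE]]] :=
  @jordan_semi_triple_small_field K (phi \o f \o psi) cardK.
- exact: inj_comp (inj_comp (can_inj phiK) f_inj) (can_inj psiK).
- by move=> x y /=; rewrite !rmorphM fJ !rmorphM.
exists (psi eps), (psi \o theta \o phi : {rmorphism D -> D}); split.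
- by case: eps1 => ->; [left | right]; rewrite ?rmorphN rmorph1.
- apply: inj_comp (can_inj phiK); apply: inj_comp (fmorph_inj theta).
  exact: can_inj psiK.
- by move=> x /=; rewrite -rmorphM -gE /= !phiK.
Qed.

Theorem proposition3p2 (D : unitRingType) (hD : division_ring D) :
  [<->
       forall f : D -> D, injective f -> jordan_semi_triple f ->
         additive_map f;

       forall f : D -> D, injective f -> jordan_semi_triple f ->
         exists (eps : D) (theta : D -> D),
           [/\ eps = 1 \/ eps = -1,
               injective theta,
               ring_endomorphism theta \/ ring_anti_endomorphism theta
             & forall x : D, f x = eps * theta x];

       [\/ isomorphic_to_Fq D 2, isomorphic_to_Fq D 3
         | isomorphic_to_Fq D 4]].
Proof.
have small_of_add (inv_add : additive_map (@GRing.inv D)) :=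
  small_of_additive_inv hD inv_add.
have invJ := inv_jordan_semi_triple hD.
have inv_inj := @invr_inj D.
tfae.
(* The passage from (i) to (ii) goes through (iii): additivity is applied to inversion first, and
   only then is [f] examined. *)
- move=> f_add f f_inj fJ.
  have D_small := small_of_add (f_add _ inv_inj invJ).
  have [eps [theta [eps1 theta_inj fE]]] :=
    jordan_semi_triple_small_form D_small f_inj fJ.
  by exists eps, theta; split=> //; left; exists theta.
(* The form of inversion makes it additive, whether [theta] preserves or reverses products. *)
- move=> f_form; apply: small_of_add.
  have [eps [theta [_ _ theta_mor invE]]] := f_form _ inv_inj invJ.
  move=> x y; rewrite !invE -mulrDr.
  by case: theta_mor => -[phi phiE]; rewrite !phiE rmorphD.
- move=> D_small f f_inj fJ x y.
  have [eps [theta [_ _ fE]]] := jordan_semi_triple_small_form D_small f_inj fJ.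
  by rewrite !fE rmorphD mulrDr.
Qed.
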